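(* Let $S\subset[0,\infty)$ be an additive sub-semigroup satisfying (S1) and (S2), and let $\mu\in\mathcal{P}_S$. If $G_\mu(z)=\sum_{\gamma\in S}\frac{d_\gamma}{z^{\gamma+1}}$ (with $d_\gamma\in\mathbb{C}$) for all $z$ with $\mathrm{Im}\,z<0$ and $|z|$ sufficiently large, then $d_\gamma=m_\gamma(\mu)$ for every $\gamma\in S$.
   Context: $\mathbb{N}=\{0,1,2,\dots\}$. Conditions on the additive sub-semigroup $S\subset[0,\infty)$: (S1) $\mathbb{N}\subset S$; (S2) there is a constant $c>0$ such that $\sharp(S\cap[n,n+1))\le c^{n+1}$ for every $n\in\mathbb{N}$. Such a constant $c$ is fixed. Sums over $S$ are understood as absolutely convergent series. The class $\mathcal{P}_S$: a probability measure $\mu$ on $\mathbb{R}$ belongs to $\mathcal{P}_S$ if there exist $\{a_\beta\}_{\beta\in S,\beta>0}\subset\mathbb{C}$ and $r,R>0$ such that the restriction of $\mu$ to $\{|x|\ge R\}$ is $$\mu|_{|x|\ge R}(dx)=\sum_{\beta\in S,\,\beta>0}\mathrm{Im}\left(a_\beta\left(\tfrac1x\right)^{\beta+1}\right)dx,$$ with $|a_\beta|\le r^\beta$ for all $\beta$ and $r<c^{-1}R$. Here $(1/x)^{\beta+1}$ is understood as $e^{i(\beta+1)\pi}|x|^{-\beta-1}$ for $x\le -R$ (and as the usual positive power for $x\ge R$). $\gamma$-complex moments: for $\mu\in\mathcal{P}_S$ there is a unique family $(m_\gamma(\mu))_{\gamma\in S}\subset\mathbb{C}$ such that $m_0(\mu)=1$,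 $|m_\gamma(\mu)|\le A^\gamma$ for all $\gamma\in S$ and some $A>0$, and the Fourier transform $\mathcal{F}_\mu(z)=\int_{\mathbb{R}}e^{ixz}\mu(dx)$ satisfies $\mathcal{F}_\mu(z)=\sum_{\gamma\in S}\frac{m_\gamma(\mu)}{\Gamma(\gamma+1)}i^\gamma z^\gamma$ for all $z>0$. The number $m_\gamma(\mu)$ is called the $\gamma$-complex moment of $\mu$. $G_\mu(z)=\int_{\mathbb{R}}\frac{1}{z-x}\mu(dx)$. Powers are principal: $z^\beta=e^{\beta\log z}$ on $\mathbb{C}\setminus(-\infty,0]$ with $-\pi<\mathrm{Im}\log z<\pi$; in particular $i^\gamma=e^{i\pi\gamma/2}$. *)

(* Defs.v *)
From HB Require Import structures.
From mathcomp Require Import all_boot all_order all_algebra.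
From mathcomp Require Import finmap.
From mathcomp Require Import all_classical all_reals all_analysis.
From mathcomp Require Import complex.

Set Implicit Arguments.
Unset Strict Implicit.
Unset Printing Implicit Defensive.

Import Order.TTheory GRing.Theory Num.Theory.
Import numFieldNormedType.Exports.
Import ComplexField.Normc.

Local Open Scope classical_set_scope.
Local Open Scope ring_scope.
Local Open Scope complex_scope.

Section ComplexFunctions.
Context {R : realType}.

Definition cexp (z : R[i]) : R[i] :=
  (expR (complex.Re z))%:C * (cos (complex.Im z) +i* sin (complex.Im z)).

(* Principal argument, in ]-pi, pi[ off the half-line ]-oo, 0]. *)
Definition carg (z : R[i]) : R :=
  if 0 <= complex.Im z then acos (complex.Re z / normc z)
  else - acos (complex.Re z / normc z).

Definition clog (z : R[i]) : R[i] := ln (normc z) +i* carg z.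

Definition cpow (z : R[i]) (b : R) : R[i] := cexp (b%:C * clog z).

(* (1/x)^b for real x != 0, with the branch e^(i b pi) |x|^(-b) for x < 0. *)
Definition inv_pow (x b : R) : R[i] :=
  if 0 < x then (x `^ (- b))%:C
  else cexp (0 +i* (b * pi)) * (`|x| `^ (- b))%:C.

Definition Gamma (s : R) : R :=
  \int[lebesgue_measure]_(t in `]0, +oo[) (t `^ (s - 1) * expR (- t)).

End ComplexFunctions.

Section Sums.
Context {R : realType} {T : choiceType}.

(* Meaningful when f is absolutely summable on S. *)
Definition rsum (S : set T) (f : T -> R) : R :=
  fine (\esum_(x in S) ((f^\+)%R x)%:E) -
  fine (\esum_(x in S) ((f^\-)%R x)%:E).

Definition csum (S : set T) (f : T -> R[i]) : R[i] :=
  rsum S (fun x => complex.Re (f x)) +i* rsum S (fun x => complex.Im (f x)).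

(* The series of the f x, x in S, converges absolutely with sum l. *)
Definition has_csum (S : set T) (f : T -> R[i]) (l : R[i]) : Prop :=
  summable S (fun x => (normc (f x))%:E) /\ csum S f = l.

End Sums.

Section Transforms.
Context {R : realType}.
Implicit Type mu : probability (measurableTypeR R) R.

Definition cintegral mu (f : R -> R[i]) : R[i] :=
  (\int[mu]_x complex.Re (f x)) +i* (\int[mu]_x complex.Im (f x)).

Definition fourier mu (z : R) : R[i] :=
  cintegral mu (fun x => cexp (0 +i* (x * z))).

Definition cauchy_transform mu (z : R[i]) : R[i] :=
  cintegral mu (fun x => (z - x%:C)^-1).

End Transforms.

Section Class.
Context {R : realType}.
Implicit Type mu : probability (measurableTypeR R) R.

Definition additive_subsemigroup (S : set R) : Prop :=
  S `<=` `[0, +oo[ /\ (forall x y, S x -> S y -> S (x + y)).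

Definition condS1 (S : set R) : Prop := forall n : nat, S n%:R.

Definition condS2 (S : set R) (c : R) : Prop :=
  forall n : nat,
    let Sn := (S `&` `[n%:R, n.+1%:R[) in
    finite_set Sn /\ (#|` fset_set Sn|)%:R <= c ^+ n.+1.

(* Under condS2 S c, the bounds on a and r make the density series absolutely
   convergent at every x with rho <= `|x|. *)
Definition classP (S : set R) (c : R) mu : Prop :=
  exists (a : R -> R[i]) (r rho : R),
    [/\ 0 < r, 0 < rho, r < c^-1 * rho,
        forall b, S b -> 0 < b -> normc (a b) <= r `^ b
      & forall B : set (measurableTypeR R), measurable B ->
          B `<=` [set x : R | rho <= `|x|] ->
          mu B = (\int[lebesgue_measure]_(x in B)
            (rsum (S `&` `]0, +oo[)
               (fun b => complex.Im (a b * inv_pow x (b + 1))))%:E)%E].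

(* m is the family of complex moments of mu: only its values on S matter, and
   these are determined by mu. *)
Definition complex_moments (S : set R) mu (m : R -> R[i]) : Prop :=
  [/\ m 0 = 1,
      exists2 A : R, 0 < A & forall g, S g -> normc (m g) <= A `^ g
    & forall z : R, 0 < z ->
        has_csum S
          (fun g => m g / (Gamma (g + 1))%:C * cpow (0 +i* 1) g * (z `^ g)%:C)
          (fourier mu z)].

End Class.

(* Main.v *)
Require Import Defs.
From HB Require Import structures.
From mathcomp Require Import all_boot all_order all_algebra.
From mathcomp Require Import all_classical all_reals all_analysis.
From mathcomp Require Import measurable_realfun.
From mathcomp Require Import complex.
From mathcomp Require Import ring lra.

Import Order.TTheory GRing.Theory Num.Theory.
Import numFieldNormedType.Exports.
Import ComplexField.Normc.

Local Open Scope classical_set_scope.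
Local Open Scope ring_scope.
Local Open Scope complex_scope.

(** For [y > 0], [1/(-iy - x) = i \int_0^oo e^(-yt) e^(ixt) dt], so by Fubini
    [G_mu(-iy) = i \int_0^oo e^(-yt) F_mu(t) dt]. Integrating the moment
    expansion of [F_mu] term by term against [e^(-yt)] turns
    [t^g / Gamma(g+1)] into [y^(-g-1)], and (S2) with [|m_g| <= A^g] gives
    absolute convergence for large [y]. Hence the series of the
    [i^(g+1) m_g y^(-g-1)] and of the [i^(g+1) d_g y^(-g-1)] agree for all
    large [y]; since [S] is locally finite, their coefficients coincide. *)

(** The proof stays on the ray [z = -iy], where the power separates into a phase and a real factor:
    (-iy)^-(g+1) = i * i^g * y^-(g+1). A complex identity then becomes two identities between real
    series in [y]. Because of the leading factor i, the real parts of the [d g * i^g] are read off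
    the imaginary part of G_mu, and their imaginary parts off minus its real part. The factor i^g is
    nonzero and is cancelled only at the end. Later lemmas treat both parts at once through a map
    [q], which stands for real or imaginary part.

    Sums over [S] have no order of summation: [rsum] is a difference of two extended nonnegative
    sums. Termwise integration is therefore done by monotone convergence, once for the positive and
    once for the negative coefficients. What makes the results finite is the bound (A/y)^g on the
    integrated terms: (S2) allows c^(n+1) exponents in [n, n+1), so the blocks decay like (cA/y)^n
    and [y] must exceed both [A] and [c * A].

    In the comparison of coefficients, (S1) makes [S] unbounded, so an exponent always has a
    successor in [S]; the gap between the two gives the decay. *)

Section real_sums.
Context {R : realType} {T : choiceType}.
Implicit Types (S : set T) (f g p q : T -> R).

(** The positive part of a sum is not the sum of the positive parts, so additivity of [rsum] cannot
    be read off its definition. It follows from the freedom, obtained here, to use any decomposition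
    into nonnegative summable functions. *)
Lemma rsum_subr S p q :
  (forall x, S x -> 0 <= p x) -> (forall x, S x -> 0 <= q x) ->
  summable S (EFin \o p) -> summable S (EFin \o q) ->
  rsum S (fun x => p x - q x) =
  fine (\esum_(x in S) (p x)%:E) - fine (\esum_(x in S) (q x)%:E).
Proof.
move=> p0 q0 sp sq.
have pE : \esum_(x in S) (p x)%:E = \esum_(x in S) `|(p x)%:E|%E.
  by apply: eq_esum => x Sx; rewrite gee0_abs// lee_fin p0.
have qE : \esum_(x in S) (q x)%:E = \esum_(x in S) `|(q x)%:E|%E.
  by apply: eq_esum => x Sx; rewrite gee0_abs// lee_fin q0.
(* [fine] sends infinite values to 0, so an identity of extended sums passes through it only once
   all four sums are known to be finite. *)
have pfin : \esum_(x in S) (p x)%:E \is a fin_num by rewrite pE -summableE.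
have qfin : \esum_(x in S) (q x)%:E \is a fin_num by rewrite qE -summableE.
have := @esumB R T S (EFin \o p) (EFin \o q) sp sq p0 q0.
have spq := summableB sp sq.
have pqE : ((EFin \o p) \- (EFin \o q))%E = EFin \o (fun x => p x - q x) by [].
have posE : \esum_(x in S) (((EFin \o p) \- (EFin \o q))%E^\+)%E x =
    \esum_(x in S) ((fun x => p x - q x)^\+ x)%:E.
  by rewrite pqE funerpos.
have negE : \esum_(x in S) (((EFin \o p) \- (EFin \o q))%E^\-)%E x =
    \esum_(x in S) ((fun x => p x - q x)^\- x)%:E.
  by rewrite pqE funerneg.
have pos_fin : \esum_(x in S) ((fun x => p x - q x)^\+ x)%:E \is a fin_num.
  rewrite -posE; move: (summable_funepos spq); rewrite summableE.
  by under eq_esum do rewrite gee0_abs ?funepos_ge0//.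
have neg_fin : \esum_(x in S) ((fun x => p x - q x)^\- x)%:E \is a fin_num.
  rewrite -negE; move: (summable_funeneg spq); rewrite summableE.
  by under eq_esum do rewrite gee0_abs ?funeneg_ge0//.
by rewrite posE negE /rsum -!fineB// => ->.
Qed.

Lemma eq_rsum S f g : {in S, f =1 g} -> rsum S f = rsum S g.
Proof.
move=> fg; rewrite /rsum; congr (fine _ - fine _); apply: eq_esum => x /mem_set/fg fgx.
  by rewrite /funrpos fgx.
by rewrite /funrneg fgx.
Qed.

Lemma le_summable S f g : (forall x, S x -> `|f x| <= g x) ->
  summable S (EFin \o g) -> summable S (EFin \o f).
Proof.
move=> fg; apply: le_lt_trans; apply: le_esum => x Sx /=.
by rewrite lee_fin (le_trans (fg _ Sx))// ler_norm.
Qed.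

Lemma summable_funrpos S f : summable S (EFin \o f) -> summable S (EFin \o f^\+).
Proof.
apply: le_lt_trans; apply: le_esum => x Sx /=.
by rewrite lee_fin ger0_norm ?funrpos_ge0// -/((Num.norm \o f) x)
  -funrposDneg lerDl ?funrneg_ge0.
Qed.

Lemma summable_funrneg S f : summable S (EFin \o f) -> summable S (EFin \o f^\-).
Proof.
apply: le_lt_trans; apply: le_esum => x Sx /=.
by rewrite lee_fin ger0_norm ?funrneg_ge0// -/((Num.norm \o f) x)
  -funrposDneg lerDr ?funrpos_ge0.
Qed.

Lemma summable_fin_num S f : (forall x, S x -> 0 <= f x) ->
  summable S (EFin \o f) -> \esum_(x in S) (f x)%:E \is a fin_num.
Proof.
move=> f0; rewrite summableE; congr (_ \is a fin_num).
by apply: eq_esum => x Sx /=; rewrite ger0_norm ?f0.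
Qed.

Lemma funrposBnegE f x : f x = f^\+ x - f^\- x.
Proof. by rewrite -{1}(funrposBneg f). Qed.

Lemma rsumB S f g : summable S (EFin \o f) -> summable S (EFin \o g) ->
  rsum S (fun x => f x - g x) = rsum S f - rsum S g.
Proof.
move=> sf sg.
have [fp fn] := (summable_funrpos _ _ sf, summable_funrneg _ _ sf).
have [gp gn] := (summable_funrpos _ _ sg, summable_funrneg _ _ sg).
transitivity (rsum S (fun x => (f^\+ x + g^\- x) - (f^\- x + g^\+ x))).
  by apply: eq_rsum => x _; rewrite (funrposBnegE f) (funrposBnegE g)
    opprB addrACA opprD.
rewrite rsum_subr; last 4 first.
- by move=> x _; rewrite addr_ge0 ?funrpos_ge0 ?funrneg_ge0.
- by move=> x _; rewrite addr_ge0 ?funrpos_ge0 ?funrneg_ge0.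
- exact: (summableD fp gn).
- exact: (summableD fn gp).
under eq_esum do rewrite EFinD.
under [in X in _ - X]eq_esum do rewrite EFinD.
rewrite !esumD; do ?[by move=> x _; rewrite lee_fin ?funrpos_ge0 ?funrneg_ge0].
rewrite !fineD; do ?[by apply: summable_fin_num => // x _;
  rewrite ?funrpos_ge0 ?funrneg_ge0].
by rewrite /rsum opprB opprD addrACA.
Qed.

(** Serves to isolate the leading term of a series when coefficients are compared. *)
Lemma rsumD1 S f a : S a -> summable S (EFin \o f) ->
  rsum S f = f a + rsum (S `\ a) f.
Proof.
move=> Sa sf.
have SI : S `&` [set a] = [set a] by apply/seteqP; split=> [x []//|x ->].
have sub g : summable S (EFin \o g) -> summable (S `\ a) (EFin \o g).
  apply: le_lt_trans; rewrite [leRHS](esumID [set a])//.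
  by rewrite setDE leeDr// esum_ge0.
have split1 g : (forall x, 0 <= g x) -> summable S (EFin \o g) ->
    fine (\esum_(x in S) (g x)%:E) = g a + fine (\esum_(x in S `\ a) (g x)%:E).
  move=> g0 sg; rewrite (esumID [set a]); last by move=> x _; rewrite lee_fin.
  rewrite SI esum_set1 ?lee_fin// fineD// -?setDE//.
  by apply: summable_fin_num => //; exact: sub.
rewrite /rsum !split1 ?funrpos_ge0 ?funrneg_ge0//.
- by rewrite opprD addrACA -funrposBnegE.
- exact: summable_funrneg.
- exact: summable_funrpos.
Qed.

Lemma le_norm_rsum S f : summable S (EFin \o f) ->
  `|rsum S f| <= fine (\esum_(x in S) `|f x|%:E).
Proof.
move=> sf; rewrite /rsum.
have [fp fn] := (summable_funrpos _ _ sf, summable_funrneg _ _ sf).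
have -> : \esum_(x in S) `|f x|%:E =
    (\esum_(x in S) (f^\+ x)%:E + \esum_(x in S) (f^\- x)%:E)%E.
  rewrite -esumD; do ?[by move=> x _; rewrite lee_fin ?funrpos_ge0 ?funrneg_ge0].
  by apply: eq_esum => x _; rewrite -EFinD -/((Num.norm \o f) x) -funrposDneg.
rewrite fineD; do ?[by apply: summable_fin_num => // x _;
  rewrite ?funrpos_ge0 ?funrneg_ge0].
rewrite (le_trans (ler_normB _ _))// !ger0_norm//; apply: fine_ge0;
  apply: esum_ge0 => x _;
  by rewrite lee_fin ?funrpos_ge0 ?funrneg_ge0.
Qed.

(** Finite subsums give one inequality for every positive factor; the same inequality for [k^-1] and
    the function [k * f] is the reverse one. *)
Lemma esumZl S f (k : R) : 0 < k -> (forall x, 0 <= f x) ->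
  \esum_(x in S) (k * f x)%:E = (k%:E * \esum_(x in S) (f x)%:E)%E.
Proof.
have ub g c : 0 < c -> (forall x, 0 <= g x) ->
    (\esum_(x in S) (c * g x)%:E <= c%:E * \esum_(x in S) (g x)%:E)%E.
  move=> c0 g0; apply: ge_ereal_sup => _ [X XS <-].
  under eq_fsbigr do rewrite EFinM.
  rewrite -ge0_mule_fsumr; last by move=> x; rewrite lee_fin.
  by rewrite lee_pmul2l// ereal_sup_ubound//; exists X.
move=> k0 f0; apply/eqP; rewrite eq_le ub//=.
have kf0 x : 0 <= k * f x by rewrite mulr_ge0// ltW.
have := ub (fun x => k * f x) k^-1; rewrite invr_gt0 => /(_ k0 kf0).
under eq_esum do rewrite mulKf ?gt_eqF//.
rewrite -(@lee_pmul2l _ k%:E)// ?lte_fin//.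
by rewrite muleA -EFinM divff ?gt_eqF// mul1e.
Qed.

End real_sums.

(** * Locally finite exponent sets: least elements, power sums, uniqueness of coefficients *)

Section locally_finite.
Context {R : realType}.
Implicit Types (S A : set R) (c : R).

Lemma bigcup_unit_itv S : S `<=` `[0, +oo[ ->
  S = \bigcup_(n in [set: nat]) (S `&` `[n%:R, n.+1%:R[).
Proof.
move=> S0; apply/seteqP; split=> [x Sx|x [n _ []]//].
have /S0/= := Sx; rewrite in_itv/= andbT => x0.
by exists (Num.trunc x) => //; split => //=; rewrite in_itv/= truncn_itv.
Qed.

Lemma trivIset_unit_itv S :
  trivIset [set: nat] (fun n => S `&` `[n%:R, n.+1%:R[%classic).
Proof.
apply/trivIsetP => i j _ _ ij; apply/seteqP; split=> // x /= [[_ xi] [_ xj]].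
move: xi xj; rewrite !in_itv/= => /andP[ix xi] /andP[jx xj].
have := le_lt_trans ix xj; have := le_lt_trans jx xi.
rewrite !ltr_nat !ltnS => ji ij'.
by move: ij; rewrite eqn_leq ij' ji.
Qed.

(** Needed to exchange sums over [S] with integrals, since monotone convergence concerns
    sequences. *)
Lemma countable_condS2 S c : S `<=` `[0, +oo[ -> condS2 S c -> countable S.
Proof.
move=> S0 S2; rewrite (bigcup_unit_itv _ S0); apply: bigcup_countable => // n _.
by apply: finite_set_countable; case: (S2 n).
Qed.

Lemma finite_set_condS2 S c (b : R) : S `<=` `[0, +oo[ -> condS2 S c ->
  finite_set (S `&` [set x | x <= b]).
Proof.
move=> S0 S2.
apply: (@sub_finite_set _ _
  (\bigcup_(n in `I_(Num.trunc b).+1) (S `&` `[n%:R, n.+1%:R[))).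
  move=> x [Sx xb].
  have /S0/= := Sx; rewrite in_itv/= andbT => x0.
  exists (Num.trunc x); last by split => //=; rewrite in_itv/= truncn_itv.
  by rewrite /= ltnS le_truncn.
by apply: bigcup_finite => // n _; case: (S2 n).
Qed.

Lemma exists_min_seq (s : seq R) : s != [::] ->
  exists2 a, a \in s & {in s, forall b, a <= b}.
Proof.
elim: s => // x s ih _.
have [->|/ih [a as_ amin]] := eqVneq s [::].
  by exists x; [rewrite mem_head|move=> b; rewrite inE => /eqP ->].
have [xa|ax] := leP x a.
  exists x; [exact: mem_head|move=> b; rewrite inE => /predU1P[->//|/amin]].
  exact: le_trans.
exists a; first by rewrite inE as_ orbT.
by move=> b; rewrite inE => /predU1P[->|/amin//]; exact: ltW.
Qed.

(** Only finitely many elements of [A] lie below a given point of [A], and the least of these is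
    least in all of [A]. *)
Lemma exists_min_condS2 S c A : S `<=` `[0, +oo[ -> condS2 S c ->
  A `<=` S -> A !=set0 -> exists2 a, A a & forall b, A b -> a <= b.
Proof.
move=> S0 S2 AS [a0 Aa0].
have : finite_set (A `&` [set x | x <= a0]).
  apply: sub_finite_set (finite_set_condS2 _ _ a0 S0 S2).
  by move=> x [/AS].
move=> /finite_seqP[s sE].
have a0s : [set` s] a0 by rewrite -sE; split => //=.
have [|a ain amin] := exists_min_seq s; first by by case: (s) a0s.
have [Aa aa0] : (A `&` [set x | x <= a0]) a by rewrite sE.
exists a => // b Ab; have [ba0|/ltW] := leP b a0; last exact: le_trans.
by apply: amin; suff : [set` s] b by []; rewrite -sE.
Qed.

(** As [x < 1], each of the at most c^(n+1) terms with exponent in [n, n+1) is at most x^n. The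
    block sums are thus dominated by the geometric series with terms c (c x)^n. *)
Lemma summable_powR S c x : S `<=` `[0, +oo[ -> 0 < c -> condS2 S c ->
  0 < x -> x < 1 -> c * x < 1 -> summable S (fun g => (x `^ g)%:E).
Proof.
move=> S0 c0 S2 x0 x1 cx1; rewrite /summable.
under eq_esum do rewrite gee0_abs ?lee_fin ?powR_ge0//.
rewrite {1}(bigcup_unit_itv _ S0) esum_bigcupT; last 2 first.
- exact: trivIset_unit_itv.
- by move=> g; rewrite lee_fin powR_ge0.
have block n : (\esum_(g in S `&` `[n%:R, n.+1%:R[%classic) (x `^ g)%:E <=
    (c * (c * x) ^+ n)%:E)%E.
  have [Sfin Scard] := S2 n.
  apply: (@le_trans _ _
      (\esum_(g in S `&` `[n%:R, n.+1%:R[%classic) (x ^+ n)%:E)%E).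
    apply: le_esum => g [_ /=]; rewrite in_itv/= => /andP[ng _].
    by rewrite lee_fin -powR_mulrn ?(ltW x0)// ger_powR// x0 ltW.
  rewrite esum_fset//; last first.
    by move=> *; rewrite lee_fin exprn_ge0// ltW.
  rewrite fsbig_finite//= sumEFin lee_fin.
  rewrite big_const_seq count_predT iter_addr_0 -[leLHS]mulr_natl.
  rewrite exprMn mulrA -exprS ler_wpM2r// exprn_ge0// ltW//.
rewrite -nneseries_esumT; last by move=> n; apply: esum_ge0 => g _;
  rewrite lee_fin powR_ge0.
apply: (@le_lt_trans _ _ (c / (1 - c * x))%:E); last by rewrite ltry.
have cx0 : 0 < c * x by rewrite mulr_gt0.
apply: lime_le.
  by apply: is_cvg_nneseries => n _ _; apply: esum_ge0 => g _; rewrite lee_fin powR_ge0.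
apply: nearW => n.
apply: (@le_trans _ _ (\sum_(0 <= k < n) (c * (c * x) ^+ k)%:E)%E).
  by apply: lee_sum => k _; exact: block.
rewrite sumEFin lee_fin.
have := geometric_seriesE c (z := c * x); rewrite lt_eqF// => /(_ isT).
move=> /(congr1 (fun u => u n)); rewrite /series/= => ->.
rewrite ler_wpM2r ?invr_ge0 ?subr_ge0 ?(ltW cx1)//.
by rewrite ler_piMr ?(ltW c0)// lerBlDr lerDl exprn_ge0// ltW.
Qed.

(* The term of least exponent with a nonzero coefficient would dominate the
   series as [y] goes to infinity. *)
Lemma rsum_powR_inj S c (h : R -> R) (K : R) :
  S `<=` `[0, +oo[ -> condS1 S -> condS2 S c ->
  (forall y, 0 < y -> K < y ->
     summable S (fun g => (h g * y `^ (- (g + 1)))%:E) /\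
     rsum S (fun g => h g * y `^ (- (g + 1))) = 0) ->
  forall g, S g -> h g = 0.
Proof.
move=> S0 S1 S2 hK g Sg; apply/eqP/negP => /negP hg.
have [] := exists_min_condS2 S c (S `&` [set x | h x != 0]) S0 S2.
- by move=> x [].
- by exists g.
move=> a [Sa /= ha] amin.
(* The next exponent [b] after [a] exists because [S] contains every natural number and so has
   elements above [a]. *)
have [] := exists_min_condS2 S c (S `&` [set x | a < x]) S0 S2.
- by move=> x [].
- by exists (Num.trunc a).+1%:R; split; [exact: S1|rewrite /= truncnS_gt].
move=> b [Sb /= ab] bmin.
pose y0 := Num.max 1 (K + 1).
have y01 : 1 <= y0 by rewrite le_max lexx.
have y00 : 0 < y0 by apply: lt_le_trans y01.
have Ky0 : K < y0 by rewrite lt_max ltrDl ltr01 orbT.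
have [sy0 _] := hK _ y00 Ky0.
pose C := fine (\esum_(x in S) `|h x * y0 `^ (- (x + 1))|%:E).
have C0 : 0 <= C by apply: fine_ge0; apply: esum_ge0 => x _; rewrite lee_fin.
(* Going from [y0] to [s * y0] multiplies the term at [a] by exactly s^-(a+1), and each later term
   by at most s^-(b+1). Since the series vanishes at [s * y0], the term at [a] is minus the sum of
   the others, which is controlled by the fixed absolute sum [C] at [y0]. *)
have bound s : 1 <= s -> `|h a| * y0 `^ (- (a + 1)) <= s `^ (a - b) * C.
  move=> s1; have s0 : 0 < s by apply: lt_le_trans s1.
  have sy0_gt0 : 0 < s * y0 by rewrite mulr_gt0.
  have Ksy0 : K < s * y0 by rewrite (lt_le_trans Ky0)// ler_peMl// ltW.
  have [ss] := hK _ sy0_gt0 Ksy0.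
  rewrite (rsumD1 S _ a)// => /eqP; rewrite addr_eq0 => /eqP haE.
  have ssa : summable (S `\ a) (EFin \o (fun g => h g * (s * y0) `^ (- (g + 1)))).
    apply: le_lt_trans ss; rewrite [leRHS](esumID [set a])//.
    by rewrite setDE leeDr// esum_ge0.
  have := le_norm_rsum _ _ ssa.
  rewrite -normrN -haE normrM (ger0_norm (powR_ge0 _ _)) powRM ?(ltW s0)
    ?(ltW y00)// => le1.
  have le2 : fine (\esum_(x in S `\ a) `|h x * (s * y0) `^ (- (x + 1))|%:E) <=
      s `^ (- (b + 1)) * C.
    rewrite -lee_fin fineK; last first.
      move: ssa; rewrite summableE; congr (_ \is a fin_num); exact: eq_esum.
    rewrite EFinM fineK; last first.
      move: sy0; rewrite summableE; congr (_ \is a fin_num); exact: eq_esum.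
    rewrite -esumZl ?powR_gt0//.
    apply: (@le_trans _ _ (\esum_(x in S `\ a)
        (s `^ (- (b + 1)) * `|h x * y0 `^ (- (x + 1))|)%:E)).
      apply: le_esum => x [Sx /= /eqP xa]; rewrite lee_fin.
      (* Exponents below [a] have coefficient 0 by minimality of [a]; any other exponent different
         from [a] is at least [b]. *)
      have [->|hx] := eqVneq (h x) 0; first by rewrite !mul0r normr0 mulr0.
      have ax : a < x by rewrite lt_neqAle eq_sym xa amin.
      rewrite !normrM !(ger0_norm (powR_ge0 _ _)) mulrCA ler_wpM2l//.
      rewrite powRM ?(ltW s0) ?(ltW y00)// ler_wpM2r ?powR_ge0// ler_powR//
        lerN2 lerD2r.
      exact: bmin.
    rewrite [leRHS](esumID [set a]); last first.
      by move=> x _; rewrite lee_fin mulr_ge0 ?powR_ge0.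
    by rewrite setDE leeDr// esum_ge0// => x _; rewrite lee_fin mulr_ge0 ?powR_ge0.
  have := le_trans le1 le2.
  rewrite mulrCA -ler_pdivlMl ?powR_gt0// -powRN opprK mulrA => le3;
    apply: (le_trans le3).
  rewrite -powRD ?(gt_eqF s0) ?implybT//.
  by rewrite opprD addrACA subrr addr0.
pose M := `|h a| * y0 `^ (- (a + 1)).
have M0 : 0 < M by rewrite mulr_gt0 ?normr_gt0 ?powR_gt0.
have ba0 : 0 < b - a by rewrite subr_gt0.
(* Chosen so that s^(b-a) M >= C + 1, whereas [bound] gives s^(b-a) M <= C. The maximum with 1 meets
   the condition of [bound]. *)
pose s := Num.max 1 (((C + 1) / M) `^ (b - a)^-1).
have s1 : 1 <= s by rewrite le_max lexx.
have CM0 : 0 < (C + 1) / M by rewrite divr_gt0// ltr_wpDl.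
have := bound s s1; rewrite -/M.
have sba : (C + 1) / M <= s `^ (b - a).
  have -> : (C + 1) / M = (((C + 1) / M) `^ (b - a)^-1) `^ (b - a).
    by rewrite -powRrM mulVf ?gt_eqF// powRr1// ltW.
  apply: ge0_ler_powR; rewrite ?nnegrE ?powR_ge0 ?(ltW ba0)//.
    by rewrite (le_trans _ s1).
  by rewrite /s le_max lexx orbT.
rewrite -opprB powRN ler_pdivlMl ?powR_gt0 ?(lt_le_trans _ s1)//.
move: sba; rewrite ler_pdivrMr// => /le_trans h1 /h1.
by rewrite leNgt ltrDl ltr01.
Qed.

End locally_finite.

(** * The Laplace transform of a real power and the Gamma integral *)

Section power_laplace.
Context {R : realType}.
Notation leb := (@lebesgue_measure R).

Lemma cvg_expRNM (y : R) : 0 < y -> expR (- (y * t)) @[t --> +oo] --> 0.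
Proof.
move=> y0; apply: (@cvg_comp _ _ _ ( *%R y) (fun t => expR (- t)) _ +oo).
  by apply: gt0_cvgMry => //; exact: cvg_id.
exact: cvgr_expR.
Qed.

Lemma integral_expRNM (y : R) : 0 < y ->
  (\int[leb]_(t in `[0%R, +oo[) (expR (- (y * t)))%:E = (y^-1)%:E)%E.
Proof.
move=> y0.
pose F t := - y^-1 * expR (- (y * t)).
have dF (t : R) : is_derive t (1 : R) F (expR (- (y * t))).
  apply: is_derive_eq.
  rewrite /GRing.scale/=.
  by field; rewrite gt_eqF.
rewrite (@ge0_continuous_FTC2y _ _ F _ 0) => //.
- by rewrite /F mulr0 oppr0 expR0 mulr1 sub0e EFinN oppeK.
- by apply: continuous_subspaceT => t; apply: differentiable_continuous;
    exact/derivable1_diffP.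
- rewrite -(mulr0 (- y^-1)); apply: cvgMr; exact: cvg_expRNM.
- apply: cvg_at_right_filter; apply: differentiable_continuous; exact/derivable1_diffP.
- by move=> t _; rewrite derive1E derive_val.
Qed.

Lemma within_continuous_powR_expRN (g : R) : 0 <= g ->
  {within `[0, +oo[, continuous (fun t : R => t `^ g * expR (- t))}.
Proof.
move=> g0; apply/continuous_within_itvcyP.
have cexp : continuous (fun t : R => expR (- t)).
  by move=> t; apply: differentiable_continuous; exact/derivable1_diffP.
split.
  move=> t t0; apply: cvgM; last exact: cexp.
  have /derivable1_diffP/differentiable_continuous : derivable (fun t : R => t
    `^ g) t 1.
    exact: derivable_powR.
  exact.
apply: cvgM; last by apply: cvg_at_right_filter; exact: cexp.
(* The power at the endpoint 0 is 1 when [g] is 0 and 0 otherwise, so right continuity there has two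
   cases. *)
have [->|gn0] := eqVneq g 0.
  by rewrite powRr0; under eq_cvg do rewrite powRr0; exact: cvg_cst.
by rewrite powR0//; apply: powR_cvg0; rewrite lt_neqAle eq_sym gn0.
Qed.

Lemma measurable_powR_expRNM (g y : R) (D : set R) :
  measurable_fun D (EFin \o (fun t : R => t `^ g * expR (- (y * t)))).
Proof.
apply: measurable_funTS; apply/measurable_EFinP; apply: measurable_funM.
  exact: measurable_powR.
by apply: measurableT_comp => //; apply: measurableT_comp => //; exact: measurable_funM.
Qed.

Lemma measurable_powR_expRN (g : R) (D : set R) :
  measurable_fun D (EFin \o (fun t : R => t `^ g * expR (- t))).
Proof.
rewrite [X in EFin \o X](_ : _ = fun t => t `^ g * expR (- (1 * t))).
  exact: measurable_powR_expRNM.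
by apply/funext => t; rewrite mul1r.
Qed.

Lemma integral_powR_expRN_scale (g y : R) : 0 <= g -> 0 < y ->
  (\int[leb]_(t in `]0%R, +oo[) (t `^ g * expR (- t))%:E =
   (y `^ (g + 1))%:E * \int[leb]_(t in `]0%R, +oo[) (t `^ g * expR (- (y * t)))%:E)%E.
Proof.
move=> g0 y0.
rewrite integral_itv_obnd_cbnd; last by exact: measurable_powR_expRN.
rewrite integral_itv_obnd_cbnd; last exact: measurable_powR_expRNM.
have derM : ( *%R y)^`()%classic = cst y.
  by apply/funext => z; rewrite derive1Ml// derive1_id mulr1.
have := @increasing_ge0_integration_by_substitutiony R ( *%R y)
  (fun t => t `^ g * expR (- t)) 0.
rewrite mulr0 => ->; last 8 first.
- by move=> a b _ _ ab; rewrite ltr_pM2l.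
- by rewrite derM => z _; exact: cvg_cst.
- by rewrite derM; exact: is_cvg_cst.
- by rewrite derM; exact: is_cvg_cst.
- split=> //; apply: cvg_at_right_filter; exact: mulrl_continuous.
- by apply: gt0_cvgMry => //; exact: cvg_id.
- exact: within_continuous_powR_expRN.
- by move=> x _; rewrite mulr_ge0 ?powR_ge0 ?expR_ge0.
rewrite derM -ge0_integralZl//; last 3 first.
- exact: measurable_powR_expRNM.
- by move=> t _; rewrite lee_fin mulr_ge0 ?powR_ge0 ?expR_ge0.
- by rewrite lee_fin powR_ge0.
apply: eq_integral => t; rewrite inE/= in_itv/= andbT => t0.
rewrite !fctE/= -EFinM; congr EFin.
rewrite powRM ?(ltW y0)// powRD; last by rewrite (gt_eqF y0) implybT.
by rewrite powRr1 ?(ltW y0)//; ring.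
Qed.

Lemma integral_powR_expRN_lty (g : R) : 0 <= g ->
  (\int[leb]_(t in `]0%R, +oo[) (t `^ g * expR (- t))%:E < +oo)%E.
Proof.
(* From ln(t/a) <= t/a one gets g ln t <= g t/a + g ln a. The choice of [a] gives g/a <= 1/2, which
   leaves half of the exponential decay, and the added 1 keeps [a] positive at [g = 0]. *)
move=> g0; pose a := 2 * g + 1.
have a0 : 0 < a by rewrite /a ltr_wpDl// mulr_ge0.
have mexp : measurable_fun (`]0%R, +oo[%classic : set R)
  (EFin \o (fun t : R => expR (- (2^-1 * t)))).
  apply: measurable_funTS; apply/measurable_EFinP.
  by apply: measurableT_comp => //; apply: measurableT_comp => //;
    exact: measurable_funM.
apply: (@le_lt_trans _ _
  (\int[leb]_(t in `]0%R, +oo[) ((expR (g * ln a))%:E * (expR (- (2^-1 * t)))%:E))%E).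
  apply: ge0_le_integral => //.
  - by move=> t _; rewrite lee_fin mulr_ge0 ?powR_ge0 ?expR_ge0.
  - exact: measurable_powR_expRN.
  - exact: measurable_funeM.
  - move=> t /=; rewrite in_itv/= andbT => t0.
    rewrite -EFinM lee_fin /powR gt_eqF// -!expRD ler_expR.
    have : ln (t / a) <= t / a by apply/ltW/ln_sublinear; rewrite divr_gt0.
    rewrite ln_div// lerBlDr => lnt.
    have : g * ln t <= g * (t / a + ln a) by rewrite ler_wpM2l.
    have : g * (t / a) <= t / 2.
      rewrite mulrCA ler_wpM2l ?(ltW t0)// ler_pdivrMr//.
      by rewrite /a mulrDr mulKf ?pnatr_eq0// mulr1 lerDl invr_ge0.
    lra.
rewrite ge0_integralZl//.
by rewrite integral_itv_obnd_cbnd// integral_expRNM ?invr_gt0// -EFinM ltry.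
Qed.

(** [Gamma] is a real-valued integral, hence a [fine]; the finiteness just shown identifies it with
    the extended integral. *)
Lemma integral_Gamma (g : R) : 0 <= g ->
  (\int[leb]_(t in `]0%R, +oo[) (t `^ g * expR (- t))%:E = (Gamma (g + 1))%:E)%E.
Proof.
move=> g0; rewrite /Gamma /Rintegral addrK fineK// ge0_fin_numE.
  exact: integral_powR_expRN_lty.
by apply: integral_ge0 => t _; rewrite lee_fin mulr_ge0 ?powR_ge0 ?expR_ge0.
Qed.

(** On [1, 2] the integrand is at least exp(-2), because t^g >= 1 there. Positivity is what later
    allows the Gamma factors to cancel. *)
Lemma Gamma_gt0 (g : R) : 0 <= g -> 0 < Gamma (g + 1).
Proof.
move=> g0; rewrite -lte_fin -integral_Gamma//.
apply: (@lt_le_trans _ _ (\int[leb]_(t in `[1%R, 2%R]) (expR (- 2))%:E)%E).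
  rewrite integral_cst//= lebesgue_measure_itv/= lte_fin ltr1n.
  by rewrite -EFinB -EFinM lte_fin mulr_gt0 ?expR_gt0// subr_gt0 ltr1n.
apply: (@le_trans _ _ (\int[leb]_(t in `[1%R, 2%R]) (t `^ g * expR (- t))%:E)%E).
  apply: ge0_le_integral => //.
  - exact: measurable_powR_expRN.
  - move=> t /=; rewrite in_itv/= => /andP[t1 t2]; rewrite lee_fin.
    rewrite -[leLHS]mul1r ler_pM ?expR_ge0// ?ler_expR ?lerN2//.
    by rewrite -(powRr0 t) ler_powR.
apply: ge0_subset_integral => //.
- exact: measurable_powR_expRN.
- by move=> t _; rewrite lee_fin mulr_ge0 ?powR_ge0 ?expR_ge0.
- by move=> t /=; rewrite !in_itv/= andbT => /andP[t1 _]; exact: lt_le_trans t1.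
Qed.

Lemma integral_powR_expRNM (g y : R) : 0 <= g -> 0 < y ->
  (\int[leb]_(t in `]0%R, +oo[) (t `^ g * expR (- (y * t)))%:E =
   (Gamma (g + 1) * y `^ (- (g + 1)))%:E)%E.
Proof.
move=> g0 y0; rewrite mulrC EFinM -integral_Gamma// (integral_powR_expRN_scale _ y)//.
by rewrite muleA -EFinM powRN mulVf ?mul1e// gt_eqF// powR_gt0.
Qed.

End power_laplace.

(** * Exchange of sums over [S] with integrals *)

Section termwise_integration.
Context {R : realType}.

(** The enumeration is fixed before the summand [a], so one choice serves all points of an
    integration domain. Indices outside [P] contribute 0, which also covers finite [S]. *)
Lemma esum_nneseries_countable (I : pointedType) (S : set I) : countable S ->
  exists (P : set nat) (e : nat -> I), forall a : I -> \bar R,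
    (forall i, 0 <= a i)%E ->
    \esum_(i in S) a i = (\sum_(0 <= k <oo) if k \in P then a (e k) else 0)%E.
Proof.
move=> /countable_bijP[P]; rewrite card_eq_sym => /card_set_bijP[e eP].
exists P, e => a a0; rewrite (reindex_esum _ _ _ _ eP) esum_mkcond nneseries_esumT//.
by move=> n; case: ifP.
Qed.

Section integral_esum.
Context d (T : measurableType d) (mu : {measure set T -> \bar R}).
Context (I : pointedType) (S : set I) (D : set T) (f : I -> T -> \bar R).
Context (Scountable : countable S) (mD : measurable D).
Context (mf : forall i, measurable_fun D (f i)).
Context (f0 : forall i x, (0 <= f i x)%E).

Lemma measurable_fun_esum :
  measurable_fun D (fun x => \esum_(i in S) f i x).
Proof.
have [P [e eE]] := esum_nneseries_countable _ _ Scountable.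
under eq_fun do rewrite eE//.
apply: ge0_emeasurable_sum => [k x _ _|k _]; first by case: ifP.
by case: (k \in P).
Qed.

Lemma integral_esum :
  (\int[mu]_(x in D) (\esum_(i in S) f i x) =
   \esum_(i in S) \int[mu]_(x in D) f i x)%E.
Proof.
have [P [e eE]] := esum_nneseries_countable _ _ Scountable.
rewrite eE; last by move=> i; apply: integral_ge0.
under eq_integral do rewrite eE//.
rewrite integral_nneseries//; last 2 first.
- by move=> k; case: (k \in P).
- by move=> k x _; case: ifP.
apply: eq_eseriesr => k _; case: (k \in P) => //.
by rewrite integral0.
Qed.

End integral_esum.

Notation leb := (@lebesgue_measure R).
Context (S : set R) (y : R).
Context (S0 : S `<=` `[0, +oo[) (Scountable : countable S) (y0 : 0 < y).

(** With nonnegative coefficients the exchange always holds in the extended reals, and finiteness of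
    the integrated sum is then integrability of the integrand. The signed case needs that
    integrability in order to subtract two integrals. *)
Lemma Rintegral_esum_powR (k : R -> R) : (forall g, 0 <= k g) ->
  (forall t, 0 < t -> summable S (fun g => (k g * t `^ g)%:E)) ->
  summable S (fun g => (k g * (Gamma (g + 1) * y `^ (- (g + 1))))%:E) ->
  leb.-integrable `]0%R, +oo[
    (EFin \o (fun t => expR (- (y * t)) * fine (\esum_(g in S) (k g * t `^ g)%:E))) /\
  \int[leb]_(t in `]0, +oo[)
    (expR (- (y * t)) * fine (\esum_(g in S) (k g * t `^ g)%:E)) =
  fine (\esum_(g in S) (k g * (Gamma (g + 1) * y `^ (- (g + 1))))%:E).
Proof.
move=> k0 sk skG.
pose f g (t : R) := (k g * (t `^ g * expR (- (y * t))))%:E.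
have f0 g t : (0 <= f g t)%E by rewrite lee_fin !mulr_ge0 ?powR_ge0 ?expR_ge0.
have mf (D : set R) g : measurable_fun D (f g).
  rewrite (_ : f g = (fun t => (k g)%:E * (t `^ g * expR (- (y * t)))%R%:E)%E)//.
  by apply: measurable_funeM; exact: measurable_powR_expRNM.
have fE t : `]0, +oo[%classic t ->
    (expR (- (y * t)) * fine (\esum_(g in S) (k g * t `^ g)%:E))%:E =
    \esum_(g in S) f g t.
  rewrite /= in_itv/= andbT => t0; rewrite EFinM fineK; last first.
    by apply: summable_fin_num (sk _ t0) => g _; rewrite mulr_ge0 ?powR_ge0.
  rewrite -esumZl ?expR_gt0//; last by move=> g; rewrite mulr_ge0 ?powR_ge0.
  by apply: eq_esum => g _; rewrite /f; congr EFin; ring.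
have intE : (\int[leb]_(t in `]0%R, +oo[) (\esum_(g in S) f g t))%E =
    \esum_(g in S) (k g * (Gamma (g + 1) * y `^ (- (g + 1))))%:E.
  rewrite (integral_esum _ _ leb _ _ _ _ Scountable _ (mf _) f0)//.
  apply: eq_esum => g /S0/=.
  rewrite in_itv/= andbT => g0; under eq_integral do rewrite /f EFinM.
  rewrite ge0_integralZl//; last 3 first.
  - exact: measurable_powR_expRNM.
  - by move=> t _; rewrite lee_fin mulr_ge0 ?powR_ge0 ?expR_ge0.
  - by rewrite lee_fin.
  by rewrite integral_powR_expRNM.
have skG_fin : \esum_(g in S) (k g * (Gamma (g + 1)
  * y `^ (- (g + 1))))%:E \is a fin_num.
  apply: summable_fin_num skG => g /S0/=; rewrite in_itv/= andbT => g0.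
  by rewrite !mulr_ge0 ?powR_ge0// ltW ?Gamma_gt0.
split; last first.
  by rewrite /Rintegral -intE; congr fine; apply: eq_integral => t; rewrite inE => /fE.
apply: (@eq_integrable _ _ _ leb _ _ (fun t => \esum_(g in S) f g t)) => //.
  by move=> t; rewrite inE => /fE /= ->.
apply/integrableP; split.
  by apply: measurable_fun_esum => [|g|g t]; [exact: Scountable|exact: mf|exact: f0].
under eq_integral do rewrite gee0_abs ?esum_ge0//.
by rewrite intE ltey_eq skG_fin.
Qed.

(** The weights are nonnegative, so splitting [h] alone by sign decomposes the terms before and
    after integration, uniformly in [t]. *)
Lemma Rintegral_rsum_powR (h : R -> R) :
  (forall t, 0 < t -> summable S (fun g => (h g * t `^ g)%:E)) ->
  summable S (fun g => (h g * (Gamma (g + 1) * y `^ (- (g + 1))))%:E) ->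
  \int[leb]_(t in `]0, +oo[)
    (expR (- (y * t)) * rsum S (fun g => h g * t `^ g)) =
  rsum S (fun g => h g * (Gamma (g + 1) * y `^ (- (g + 1)))).
Proof.
move=> sh shG.
have W0 g : S g -> 0 <= Gamma (g + 1) * y `^ (- (g + 1)).
  by move=> /S0/=; rewrite in_itv/= andbT => g0; rewrite mulr_ge0 ?powR_ge0//
    ltW ?Gamma_gt0.
have hp g : h^\+ g <= `|h g| by rewrite -/((Num.norm \o h) g)
  -funrposDneg lerDl ?funrneg_ge0.
have hn g : h^\- g <= `|h g| by rewrite -/((Num.norm \o h) g)
  -funrposDneg lerDr ?funrpos_ge0.
have sub (k w : R -> R) : (forall g, 0 <= k g <= `|h g|) -> (forall g,
  S g -> 0 <= w g) ->
    summable S (fun g => (h g * w g)%:E) -> summable S (fun g => (k g * w g)%:E).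
  move=> kh w0; apply: le_lt_trans; apply: le_esum => g Sg /=; have /andP[k0 kg]
    := kh g.
  by rewrite lee_fin !normrM (ger0_norm k0) ler_wpM2r.
have hp' g : 0 <= h^\+ g <= `|h g| by rewrite funrpos_ge0 hp.
have hn' g : 0 <= h^\- g <= `|h g| by rewrite funrneg_ge0 hn.
have shp t t0 := sub _ (fun g => t `^ g) hp' (fun g _ => powR_ge0 _ _) (sh t t0).
have shn t t0 := sub _ (fun g => t `^ g) hn' (fun g _ => powR_ge0 _ _) (sh t t0).
have shGp := sub _ _ hp' W0 shG.
have shGn := sub _ _ hn' W0 shG.
have split_rsum w : (forall g, S g -> 0 <= w g) ->
    summable S (fun g => (h^\+ g * w g)%:E)
      -> summable S (fun g => (h^\- g * w g)%:E) ->
    rsum S (fun g => h g * w g) = fine (\esum_(g in S) (h^\+ g * w g)%:E) -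
      fine (\esum_(g in S) (h^\- g * w g)%:E).
  move=> w0 sp sn; rewrite -rsum_subr//.
  - by apply: eq_rsum => g _; rewrite (funrposBnegE h) mulrBl.
  - by move=> g /w0 wg; rewrite mulr_ge0 ?funrpos_ge0.
  - by move=> g /w0 wg; rewrite mulr_ge0 ?funrneg_ge0.
rewrite [RHS]split_rsum//.
have [ip <-] := Rintegral_esum_powR _ (@funrpos_ge0 _ _ h) shp shGp.
have [in_ <-] := Rintegral_esum_powR _ (@funrneg_ge0 _ _ h) shn shGn.
rewrite -RintegralB//; apply: eq_Rintegral => t.
rewrite inE/= in_itv/= andbT => t0; rewrite -mulrBr split_rsum//.
- by move=> g _; exact: powR_ge0.
- exact: shp.
- exact: shn.
Qed.

End termwise_integration.

(** * Laplace integrals of sine and cosine, and Fubini against [mu] *)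

Section laplace.
Context {R : realType}.
Notation leb := (@lebesgue_measure R).

Lemma measurable_expRNM (y : R) (D : set R) :
  measurable_fun D (fun t : R => expR (- (y * t))).
Proof.
apply: measurable_funTS; apply: measurableT_comp => //.
by apply: measurableT_comp => //; exact: measurable_funM.
Qed.

Lemma integrable_expRNM (y : R) : 0 < y ->
  leb.-integrable `]0%R, +oo[ (EFin \o (fun t => expR (- (y * t)))).
Proof.
move=> y0; apply/integrableP; split.
  by apply/measurable_EFinP; exact: measurable_expRNM.
under eq_integral do rewrite gee0_abs ?lee_fin ?expR_ge0//.
rewrite integral_itv_obnd_cbnd ?integral_expRNM ?ltry//.
by apply/measurable_EFinP; exact: measurable_expRNM.
Qed.

Lemma integrable_expRNM_bounded (y : R) (k : R -> R) : 0 < y ->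
  measurable_fun [set: R] k -> (forall t, `|k t| <= 1) ->
  leb.-integrable `]0%R, +oo[ (EFin \o (fun t => expR (- (y * t)) * k t)).
Proof.
move=> y0 mk k1.
apply: le_integrable (integrable_expRNM _ y0) => //.
  apply/measurable_EFinP; apply: measurable_funM; first exact: measurable_expRNM.
  exact: measurable_funTS.
move=> t _ /=; rewrite lee_fin normrM ger_pMr ?normr_gt0 ?gt_eqF ?expR_gt0 ?k1//.
Qed.

(* [1 + k] is nonnegative, so that the fundamental theorem on a half-line
   applies to it. *)
Lemma Rintegral_expRNM_primitive (y C : R) (k P : R -> R) : 0 < y ->
  continuous k -> (forall t, `|k t| <= 1) -> (forall t, `|P t| <= C) ->
  (forall t : R, is_derive t 1 (fun t => expR (- (y * t)) * P t)
     (expR (- (y * t)) * k t)) ->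
  \int[leb]_(t in `]0, +oo[) (expR (- (y * t)) * k t) = - P 0.
Proof.
move=> y0 kcont k1 PC dP.
have mk : measurable_fun [set: R] k by exact: continuous_measurable_fun.
(* The second summand is a primitive of the exponential added to make the integrand nonnegative; its
   contribution [y^-1] cancels at the end. Boundedness of [P] makes [F] vanish at infinity. *)
pose F (t : R) := expR (- (y * t)) * P t - y^-1 * expR (- (y * t)).
have dF (t : R) : is_derive t (1 : R) F (expR (- (y * t)) * (1 + k t)).
  apply: is_derive_eq; rewrite /GRing.scale/=.
  by field; rewrite gt_eqF.
have cF : continuous F.
  by move=> t; apply: differentiable_continuous; exact/derivable1_diffP.
have FTC : (\int[leb]_(t in `[0%R, +oo[) (expR (- (y * t)) * (1 + k t))%:E =
    (y^-1 - P 0)%:E)%E.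
  rewrite (@ge0_continuous_FTC2y _ _ F _ 0) => //.
  - by rewrite /F mulr0 oppr0 expR0 mulr1 mul1r sub0e -EFinN opprB.
  - move=> t _; rewrite mulr_ge0 ?expR_ge0//.
    by have := k1 t; rewrite ler_norml => /andP[? _]; lra.
  - apply: continuous_subspaceT => t; apply: cvgM.
      by have /derivable1_diffP/differentiable_continuous : derivable (fun t :
        R => expR (- (y * t))) t 1 by [].
    by apply: cvgD; [exact: cvg_cst|exact: kcont].
  - rewrite -[0]subr0; apply: cvgB; last first.
      by rewrite -(mulr0 y^-1); apply: cvgMr; exact: cvg_expRNM.
    apply: (@squeeze_cvgr _ _ _ _ (fun t => - C * expR (- (y * t)))
        (fun t => C * expR (- (y * t)))).
    + apply: nearW => t; rewrite mulNr -ler_norml normrM ger0_norm ?expR_ge0//.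
      by rewrite mulrC ler_wpM2r ?expR_ge0.
    + by rewrite -(mulr0 (- C)); apply: cvgMr; exact: cvg_expRNM.
    + by rewrite -(mulr0 C); apply: cvgMr; exact: cvg_expRNM.
  - by apply: cvg_at_right_filter; exact: cF.
  - by move=> t _; rewrite derive1E derive_val.
have m1k : measurable_fun [set: R] (fun t => expR (- (y * t)) * (1 + k t)).
  apply: measurable_funM; first exact: measurable_expRNM.
  exact: measurable_funD.
have R1 : \int[leb]_(t in `]0, +oo[) (expR (- (y * t)) * (1 + k t)) = y^-1 - P 0.
  rewrite /Rintegral integral_itv_obnd_cbnd ?FTC//.
  by apply/measurable_EFinP; exact: measurable_funTS.
have R2 : \int[leb]_(t in `]0, +oo[) expR (- (y * t)) = y^-1.
  rewrite /Rintegral integral_itv_obnd_cbnd ?integral_expRNM//.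
  by apply/measurable_EFinP; exact: measurable_expRNM.
have := RintegralD _ (integrable_expRNM _ y0) (integrable_expRNM_bounded _ _ y0 mk k1).
move=> /(_ (measurable_itv _)).
under eq_Rintegral do rewrite -[X in X + _]mulr1 -mulrDr.
rewrite R1 R2 => /addrI ->.
by [].
Qed.

Lemma sqrD_gt0 (x y : R) : 0 < y -> 0 < x ^+ 2 + y ^+ 2.
Proof. by move=> y0; rewrite ltr_wpDl ?sqr_ge0// exprn_gt0. Qed.

Lemma norm_cos_le1 (x : R) : `|cos x| <= 1.
Proof. by rewrite ler_norml cos_geN1 cos_le1. Qed.

Lemma norm_sin_le1 (x : R) : `|sin x| <= 1.
Proof. by rewrite ler_norml sin_geN1 sin_le1. Qed.

Lemma Rintegral_expRNM_cos (x y : R) : 0 < y ->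
  \int[leb]_(t in `]0, +oo[) (expR (- (y * t)) * cos (x * t)) =
  y / (x ^+ 2 + y ^+ 2).
Proof.
move=> y0; have q0 := sqrD_gt0 x y y0.
(* The real part of e^(ixt) / (ix - y), from the primitive of e^((ix-y)t). *)
pose P t := (x * sin (x * t) - y * cos (x * t)) / (x ^+ 2 + y ^+ 2).
have dP (t : R) : is_derive t (1 : R) (fun t => expR (- (y * t)) * P t)
    (expR (- (y * t)) * cos (x * t)).
  by apply: is_derive_eq; rewrite /GRing.scale/= /P; field; rewrite gt_eqF.
rewrite (@Rintegral_expRNM_primitive y ((`|x| + y) / (x ^+ 2 + y ^+ 2))
  (fun t => cos (x * t)) P y0 _ _ _ dP).
- by rewrite /P mulr0 sin0 cos0 mulr0 sub0r mulr1 mulNr opprK.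
- move=> t; apply: continuous_comp; first exact: mulrl_continuous.
  exact: continuous_cos.
- by move=> t; exact: norm_cos_le1.
- move=> t; rewrite normrM [X in _ * X]ger0_norm ?invr_ge0 ?(ltW q0)//.
  rewrite ler_wpM2r ?invr_ge0 ?(ltW q0)// (le_trans (ler_normB _ _))// !normrM lerD//.
    by rewrite ler_piMr ?norm_sin_le1.
  by rewrite (gtr0_norm y0) ler_piMr ?norm_cos_le1// ltW.
Qed.

Lemma Rintegral_expRNM_sin (x y : R) : 0 < y ->
  \int[leb]_(t in `]0, +oo[) (expR (- (y * t)) * sin (x * t)) =
  x / (x ^+ 2 + y ^+ 2).
Proof.
move=> y0; have q0 := sqrD_gt0 x y y0.
(* The imaginary part of the same quotient e^(ixt) / (ix - y). *)
pose P t := - (y * sin (x * t) + x * cos (x * t)) / (x ^+ 2 + y ^+ 2).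
have dP (t : R) : is_derive t (1 : R) (fun t => expR (- (y * t)) * P t)
    (expR (- (y * t)) * sin (x * t)).
  by apply: is_derive_eq; rewrite /GRing.scale/= /P; field; rewrite gt_eqF.
rewrite (@Rintegral_expRNM_primitive y ((y + `|x|) / (x ^+ 2 + y ^+ 2))
  (fun t => sin (x * t)) P y0 _ _ _ dP).
- by rewrite /P mulr0 sin0 cos0 mulr0 add0r mulr1 mulNr opprK.
- move=> t; apply: continuous_comp; first exact: mulrl_continuous.
  exact: continuous_sin.
- by move=> t; exact: norm_sin_le1.
- move=> t; rewrite normrM [X in _ * X]ger0_norm ?invr_ge0 ?(ltW q0)//.
  rewrite ler_wpM2r ?invr_ge0 ?(ltW q0)// normrN (le_trans (ler_normD _ _))//
    !normrM lerD//.
    by rewrite (gtr0_norm y0) ler_piMr ?norm_sin_le1// ltW.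
  by rewrite ler_piMr ?norm_cos_le1.
Qed.

(** The integrand on the product space is dominated by exp(-yt) on the half-line, whose integral is
    [y^-1] because [mu] has mass 1. *)
Lemma Fubini_laplace (mu : probability (measurableTypeR R) R) (y : R) (k : R -> R) :
  0 < y -> continuous k -> (forall t, `|k t| <= 1) ->
  \int[mu]_x (\int[leb]_(t in `]0, +oo[) (expR (- (y * t)) * k (x * t))) =
  \int[leb]_(t in `]0, +oo[) (expR (- (y * t)) * \int[mu]_x k (x * t)).
Proof.
move=> y0 kcont k1.
have mk : measurable_fun [set: R] k by exact: continuous_measurable_fun.
pose D : set R := `]0, +oo[%classic.
have mD : measurable D by exact: measurable_itv.
(* The indicator encodes the half-line in the integrand, so that Fubini can be applied on the whole
   product space. *)
pose f (z : R * R) := (expR (- (y * z.2)) * k (z.1 * z.2)) * \1_D z.2.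
have mf : measurable_fun [set: measurableTypeR R * measurableTypeR R] f.
  apply: measurable_funM; last by apply: measurableT_comp => //;
    exact: measurable_indic.
  apply: measurable_funM.
    by apply: (measurableT_comp (measurable_expRNM y setT)).
  by apply: measurableT_comp => //; exact: measurable_funM.
have fE x : (fun t => (f (x, t))%:E) =
    (EFin \o (fun t => expR (- (y * t)) * k (x * t))) \_ D.
  apply/funext => t; rewrite /f patchE indicE /=.
  by case: ifP => _; rewrite ?mulr1 ?mulr0.
have mkx x : measurable_fun [set: R] (fun t => k (x * t)).
  by apply: measurableT_comp => //; exact: measurable_funM.
have intx x : leb.-integrable `]0%R, +oo[ (EFin \o (fun t => expR (- (y * t))
  * k (x * t))).
  exact: integrable_expRNM_bounded.
have imf : (mu \x leb)%E.-integrable setT (EFin \o f).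
  pose g (z : R * R) := expR (- (y * z.2)) * \1_D z.2.
  have mg : measurable_fun [set: measurableTypeR R * measurableTypeR R] g.
    apply: measurable_funM; last by apply: measurableT_comp => //;
      exact: measurable_indic.
    by apply: (measurableT_comp (measurable_expRNM y setT)).
  apply: (@le_integrable _ _ _ (mu \x leb)%E _ _ _ (EFin \o g)) => //;
    first exact/measurable_EFinP.
    move=> [x t] _ /=; rewrite lee_fin /f /g/= !normrM mulrAC ler_piMr//.
  apply/integrable12ltyP; first exact/measurable_EFinP.
  rewrite (eq_integral (fun=> (y^-1)%:E)).
    rewrite integral_cst// [X in (_ * X)%E](_ : _ = 1%E) ?mule1 ?ltry//.
    exact: probability_setT.
  move=> x _; rewrite -(integral_expRNM _ y0) -integral_itv_obnd_cbnd; last first.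
    by apply/measurable_EFinP; exact: measurable_expRNM.
  rewrite [RHS]integral_mkcond; apply: eq_integral => t _.
  rewrite /g /= patchE indicE; case: ifP => _; rewrite ?mulr1 ?mulr0 ?normr0//.
  by rewrite ger0_norm ?expR_ge0.
have inner x : (\int[leb]_t (f (x, t))%:E)%E =
    (\int[leb]_(t in `]0, +oo[) (expR (- (y * t)) * k (x * t)))%:E.
  rewrite fE -integral_mkcond /Rintegral fineK//.
  exact: (integrable_fin_num _ (intx x)).
rewrite {1}/Rintegral; under eq_integral do rewrite -inner.
rewrite (Fubini imf) Rintegral_mkcond /Rintegral; congr fine; apply: eq_integral => t _.
rewrite patchE /f /=.
case: ifPn => tD; last first.
  by rewrite indicE (negbTE tD); under eq_integral do rewrite mulr0; rewrite integral0.
rewrite indicE tD; under eq_integral do rewrite mulr1 EFinM.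
have ik : mu.-integrable setT (fun x => (k (x * t))%:E).
  apply: (@le_integrable _ _ _ mu _ _ _ (cst 1%E)) => //.
  - by apply/measurable_EFinP; apply: measurableT_comp => //; exact: measurable_funM.
  - by move=> x _; rewrite /= normr1 lee_fin.
  - exact: finite_measure_integrable_cst.
by rewrite integralZl// EFinM fineK// integrable_fin_num.
Qed.

End laplace.

(** * Real and imaginary parts of absolutely convergent complex sums *)

Section complex_sums.
Context {R : realType}.

Lemma rsumN (T : choiceType) (S : set T) (f : T -> R) :
  rsum S (fun x => - f x) = - rsum S f.
Proof.
rewrite /rsum opprB; congr (fine _ - fine _); apply: eq_esum => x _.
by rewrite -(funrnegN f).
Qed.

Lemma norm_Re_le (z : R[i]) : `|complex.Re z| <= normc z.
Proof. by case: z => a b; rewrite /= -sqrtr_sqr ler_wsqrtr// lerDl sqr_ge0. Qed.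

Lemma norm_Im_le (z : R[i]) : `|complex.Im z| <= normc z.
Proof. by case: z => a b; rewrite /= -sqrtr_sqr ler_wsqrtr// lerDr sqr_ge0. Qed.

Lemma ReM_real (z : R[i]) (r : R) : complex.Re (z * r%:C) = complex.Re z * r.
Proof. by case: z => a b /=; rewrite mulr0 subr0. Qed.

Lemma ImM_real (z : R[i]) (r : R) : complex.Im (z * r%:C) = complex.Im z * r.
Proof. by case: z => a b /=; rewrite mulr0 add0r. Qed.

Lemma has_csum_Re (T : choiceType) (S : set T) (f : T -> R[i]) (l : R[i]) (g : T -> R) :
  has_csum S f l -> (forall x, S x -> complex.Re (f x) = g x) ->
  summable S (fun x => (g x)%:E) /\ rsum S g = complex.Re l.
Proof.
move=> [sf <-] fg; split.
  by apply: le_summable sf => x Sx; rewrite -fg// norm_Re_le.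
by apply: eq_rsum => x; rewrite inE => /fg.
Qed.

Lemma has_csum_Im (T : choiceType) (S : set T) (f : T -> R[i]) (l : R[i]) (g : T -> R) :
  has_csum S f l -> (forall x, S x -> complex.Im (f x) = g x) ->
  summable S (fun x => (g x)%:E) /\ rsum S g = complex.Im l.
Proof.
move=> [sf <-] fg; split.
  by apply: le_summable sf => x Sx; rewrite -fg// norm_Im_le.
by apply: eq_rsum => x; rewrite inE => /fg.
Qed.

End complex_sums.

(** * Powers and the Cauchy transform at [-iy] *)

Section imaginary_axis.
Context {R : realType}.
Notation leb := (@lebesgue_measure R).

Lemma cexp_imaginary (w : R) : cexp (0 +i* w) = cos w +i* sin w.
Proof. by rewrite /cexp /= expR0 mul1r. Qed.

Lemma normc_Nimaginary (y : R) : 0 < y -> normc (0 +i* (- y)) = y.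
Proof. by move=> y0; rewrite /= expr0n add0r sqrrN sqrtr_sqr gtr0_norm. Qed.

Lemma cpow_i (b : R) : cpow (0 +i* 1) b = cos (b * (pi / 2)) +i* sin (b * (pi / 2)).
Proof.
rewrite /cpow /clog /carg /= ler01 expr0n add0r expr1n sqrtr1 ln1 mul0r acos0.
by rewrite -cexp_imaginary; congr cexp; simpc.
Qed.

Lemma cpow_i_neq0 (b : R) : cpow (0 +i* 1) b != 0.
Proof.
rewrite cpow_i eq_complex /=; apply/negP => /andP[/eqP c0 /eqP s0].
have := cos2Dsin2 (b * (pi / 2)); rewrite c0 s0 expr0n addr0 => /eqP.
by rewrite eq_sym oner_eq0.
Qed.

Lemma normc_cpow_i (b : R) : normc (cpow (0 +i* 1) b) = 1.
Proof. by rewrite cpow_i /= cos2Dsin2 sqrtr1. Qed.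

(** The imaginary part is negative, so [carg] takes its second branch and equals -pi/2. The 1 in the
    exponent is a quarter turn, which exchanges sine and cosine. *)
Lemma cpow_Nimaginary (y b : R) : 0 < y ->
  cpow (0 +i* (- y)) (b + 1) =
  (y `^ (b + 1))%:C * (- sin (b * (pi / 2)) -i* cos (b * (pi / 2))).
Proof.
move=> y0; rewrite /cpow /clog normc_Nimaginary//
  /carg normc_Nimaginary//= lerNr oppr0 leNgt y0 /=.
rewrite mul0r acos0 /cexp /= !mul0r subr0 addr0 -[expR _]/(expR ((b + 1) * ln y)).
rewrite /powR gt_eqF//; congr (_ * _).
rewrite mulrN cosN sinN mulrDl mul1r.
by congr (_ +i* _); rewrite ?cosDpihalf ?sinDpihalf.
Qed.

(** The quotient equals i * (d * i^b) * y^-(b+1), and multiplication by i swaps real and imaginary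
    parts up to one sign. *)
Lemma div_cpow_Nimaginary (y b : R) (d : R[i]) : 0 < y ->
  complex.Re (d / cpow (0 +i* (- y)) (b + 1)) =
    - (complex.Im (d * cpow (0 +i* 1) b) * y `^ (- (b + 1))) /\
  complex.Im (d / cpow (0 +i* (- y)) (b + 1)) =
    complex.Re (d * cpow (0 +i* 1) b) * y `^ (- (b + 1)).
Proof.
move=> y0.
have -> : d / cpow (0 +i* (- y)) (b + 1) =
    (0 +i* 1) * (d * cpow (0 +i* 1) b) * (y `^ (- (b + 1)))%:C.
  (* The inverse is found by checking that a product is 1, which comes down to cos^2 + sin^2 = 1. *)
  have /mulr1_eq -> : cpow (0 +i* (- y)) (b + 1) *
      ((0 +i* 1) * cpow (0 +i* 1) b * (y `^ (- (b + 1)))%:C) = 1.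
    rewrite cpow_Nimaginary// cpow_i powRN.
    have r0 : y `^ (b + 1) != 0 by rewrite gt_eqF// powR_gt0.
    have := cos2Dsin2 (b * (pi / 2)).
    move: (cos _) (sin _) => u v uv; rewrite mulrACA [(y `^ _)%:C * _]mulrC.
    apply/eqP; rewrite eq_complex /=; apply/andP; split; apply/eqP; last by ring.
    by transitivity ((u ^+ 2 + v ^+ 2) * (y `^ (b + 1) / y `^ (b + 1)));
      [ring|rewrite uv divff// mulr1].
  by rewrite !mulrA [d * _]mulrC.
rewrite ReM_real ImM_real; case: (d * _) => u v /=.
by rewrite !mul0r !mul1r sub0r add0r mulNr.
Qed.

(** Negation swaps the integrals of the positive and negative parts. If one of them is infinite,
    [fine] makes both sides 0, so the identity covers non-integrable [f] too. *)
Lemma RintegralN d (T : measurableType d) (mu : {measure set T -> \bar R})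
  (D : set T) (f : T -> R) :
  \int[mu]_(x in D) (- f x) = - \int[mu]_(x in D) f x.
Proof.
rewrite /Rintegral integralE [in RHS]integralE.
rewrite -[fun x => (- f x)%:E]/(\- (EFin \o f))%E funeposN funenegN.
by case: (integral mu D _) (integral mu D _) => [r| |] [s| |] //=;
  rewrite ?oppr0 ?opprB.
Qed.

Context (mu : probability (measurableTypeR R) R).

Lemma Re_fourier t : complex.Re (fourier mu t) = \int[mu]_x cos (x * t).
Proof. by apply: eq_Rintegral => x _; rewrite cexp_imaginary. Qed.

Lemma Im_fourier t : complex.Im (fourier mu t) = \int[mu]_x sin (x * t).
Proof. by apply: eq_Rintegral => x _; rewrite cexp_imaginary. Qed.

(** The real part of 1/(-iy - x) is -x/(x^2 + y^2), minus the Laplace integral of sin(xt); the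
    imaginary part y/(x^2 + y^2) is that of cos(xt). *)
Lemma Re_cauchy_transform y : 0 < y ->
  complex.Re (cauchy_transform mu (0 +i* (- y))) =
  - \int[leb]_(t in `]0, +oo[) (expR (- (y * t)) * complex.Im (fourier mu t)).
Proof.
move=> y0; under eq_Rintegral do rewrite Im_fourier.
rewrite -Fubini_laplace//; [|exact: continuous_sin|exact: norm_sin_le1].
rewrite -RintegralN; apply: eq_Rintegral => x _ /=.
by rewrite Rintegral_expRNM_sin// sub0r subr0 !sqrrN mulNr.
Qed.

Lemma Im_cauchy_transform y : 0 < y ->
  complex.Im (cauchy_transform mu (0 +i* (- y))) =
  \int[leb]_(t in `]0, +oo[) (expR (- (y * t)) * complex.Re (fourier mu t)).
Proof.
move=> y0; under eq_Rintegral do rewrite Re_fourier.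
rewrite -Fubini_laplace//; [|exact: continuous_cos|exact: norm_cos_le1].
apply: eq_Rintegral => x _ /=.
by rewrite Rintegral_expRNM_cos// sub0r subr0 !sqrrN mulNr opprK.
Qed.

End imaginary_axis.

(** * The Laplace transform of the moment expansion *)

Section moment_series.
Context {R : realType}.
Notation leb := (@lebesgue_measure R).
Implicit Types (S : set R) (m : R -> R[i]).

(** Since i^g has modulus 1 and [1 <= y] gives y^-(g+1) <= y^-g, the terms are at most (A/y)^g; the
    last two bounds on [y] make these summable. *)
Lemma summable_moments S c m (q : R[i] -> R) (A y : R) :
  S `<=` `[0, +oo[ -> 0 < c -> condS2 S c ->
  0 < A -> (forall g, S g -> normc (m g) <= A `^ g) ->
  (forall z, `|q z| <= normc z) ->
  1 <= y -> A < y -> c * A < y ->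
  summable S (fun g => (q (m g * cpow (0 +i* 1) g) * y `^ (- (g + 1)))%:E).
Proof.
move=> S0 c0 S2 A0 mA qn y1 Ay cAy.
have y0 : 0 < y by apply: lt_le_trans y1.
apply: (le_summable _ _ (fun g => (A / y) `^ g)); last first.
  apply: (summable_powR _ c) => //; first by rewrite divr_gt0.
    by rewrite ltr_pdivrMr// mul1r.
  by rewrite mulrA ltr_pdivrMr// mul1r.
move=> g Sg; rewrite normrM (ger0_norm (powR_ge0 _ _)).
apply: (@le_trans _ _ (A `^ g * y `^ (- g))).
  rewrite ler_pM ?powR_ge0//; last by rewrite ler_powR// lerN2 lerDl.
  by rewrite (le_trans (qn _))// normcM normc_cpow_i mulr1 mA.
by rewrite powRM ?(ltW A0) ?invr_ge0 ?(ltW y0)// -powR_inv1 ?(ltW y0)// -powRrM mulN1r.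
Qed.

(** Here [u] is meant to be the part of the Fourier transform selected by [q]. The Gamma factor
    produced by integrating t^g cancels the one in the moment series. *)
Lemma Rintegral_moments S c m (q : R[i] -> R) (A y : R) (u : R -> R) :
  S `<=` `[0, +oo[ -> 0 < c -> condS2 S c ->
  0 < A -> (forall g, S g -> normc (m g) <= A `^ g) ->
  (forall z, `|q z| <= normc z) ->
  1 <= y -> A < y -> c * A < y ->
  (forall t, 0 < t ->
    summable S (fun g => (q (m g * cpow (0 +i* 1) g) / Gamma (g + 1) * t `^ g)%:E) /\
    rsum S (fun g => q (m g * cpow (0 +i* 1) g) / Gamma (g + 1) * t `^ g) = u t) ->
  \int[leb]_(t in `]0, +oo[) (expR (- (y * t)) * u t) =
  rsum S (fun g => q (m g * cpow (0 +i* 1) g) * y `^ (- (g + 1))).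
Proof.
move=> S0 c0 S2 A0 mA qn y1 Ay cAy mu_.
have y0 : 0 < y by apply: lt_le_trans y1.
have GE g : S g -> q (m g * cpow (0 +i* 1) g) / Gamma (g + 1) *
    (Gamma (g + 1) * y `^ (- (g + 1))) =
    q (m g * cpow (0 +i* 1) g) * y `^ (- (g + 1)).
  move=> /S0/=; rewrite in_itv/= andbT => g0.
  by rewrite mulrA divfK// gt_eqF// Gamma_gt0.
transitivity (\int[leb]_(t in `]0, +oo[) (expR (- (y * t)) *
    rsum S (fun g => q (m g * cpow (0 +i* 1) g) / Gamma (g + 1) * t `^ g))).
  apply: eq_Rintegral => t; rewrite inE/= in_itv/= andbT => t0.
  by have [_ ->] := mu_ t t0.
rewrite Rintegral_rsum_powR//.
- by apply: eq_rsum => g; rewrite inE; exact: GE.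
- exact: countable_condS2 S2.
- by move=> t t0; have [] := mu_ t t0.
- have := summable_moments _ c _ _ _ y S0 c0 S2 A0 mA qn y1 Ay cAy.
  by apply: le_lt_trans; apply: le_esum => g Sg; rewrite /= GE.
Qed.

End moment_series.

Theorem theorem3p4 (R : realType) (S : set R) (c : R)
  (S_semigroup : additive_subsemigroup S) (S1 : condS1 S)
  (c_gt0 : 0 < c) (S2 : condS2 S c)
  (mu : probability (measurableTypeR R) R) (mu_in_PS : classP S c mu)
  (m : R -> R[i]) (m_moments : complex_moments S mu m)
  (d : R -> R[i])
  (G_expansion : exists K : R, forall z : R[i], complex.Im z < 0 -> K < normc z ->
     has_csum S (fun g => d g / cpow z (g + 1)) (cauchy_transform mu z)) :
  forall g : R, S g -> d g = m g.
Proof.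
have [S0 _] := S_semigroup.
have [_ [A A0 mA] mF] := m_moments.
have [K GK] := G_expansion.
pose e (g : R) : R[i] := cpow (0 +i* 1) g.
(* The Gamma and power factors are real; collecting them on the right lets real and imaginary parts
   act on [m g * e g] alone. *)
have mFE g t : m g / (Gamma (g + 1))%:C * cpow (0 +i* 1) g * (t `^ g)%:C =
    m g * e g * ((Gamma (g + 1))^-1)%:C * (t `^ g)%:C.
  by congr (_ * _); rewrite fmorphV mulrAC.
have mReE g t : complex.Re (m g / (Gamma (g + 1))%:C * cpow (0 +i* 1) g * (t `^ g)%:C) =
    complex.Re (m g * e g) / Gamma (g + 1) * t `^ g by rewrite mFE !ReM_real.
have mImE g t : complex.Im (m g / (Gamma (g + 1))%:C * cpow (0 +i* 1) g * (t `^ g)%:C) =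
    complex.Im (m g * e g) / Gamma (g + 1) * t `^ g by rewrite mFE !ImM_real.
have mRe t (t0 : 0 < t) := has_csum_Re _ _ _ _ _ (mF t t0) (fun g _ => mReE g t).
have mIm t (t0 : 0 < t) := has_csum_Im _ _ _ _ _ (mF t t0) (fun g _ => mImE g t).
(* [K] gives validity of the expansion of G_mu; 1, [A] and [c * A] are the thresholds for absolute
   convergence of the moment series. *)
pose K' := Num.max (Num.max 1 K) (Num.max A (c * A)).
have large y : K' < y -> [/\ 0 < y, 1 <= y, K < y, A < y & c * A < y].
  rewrite /K' !gt_max => /andP[/andP[y1 Ky] /andP[Ay cAy]].
  by split => //; [exact: lt_trans y1|exact: ltW].
have GN y : K' < y -> has_csum S (fun g => d g / cpow (0 +i* (- y)) (g + 1))
    (cauchy_transform mu (0 +i* (- y))).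
  by move=> /large[y0 _ Ky _ _]; apply: GK; rewrite ?normc_Nimaginary//= oppr_lt0.
have coef (q : R[i] -> R) : (forall z, `|q z| <= normc z) ->
    (forall y, K' < y ->
      summable S (fun g => (q (d g * e g) * y `^ (- (g + 1)))%:E) /\
      rsum S (fun g => q (d g * e g) * y `^ (- (g + 1))) =
      rsum S (fun g => q (m g * e g) * y `^ (- (g + 1)))) ->
    forall g, S g -> q (d g * e g) = q (m g * e g).
  move=> qn dm g Sg; apply/eqP; rewrite -subr_eq0; apply/eqP.
  apply: (rsum_powR_inj S c (fun g => q (d g * e g) - q (m g * e g)) K') => // y _ Ky.
  have [sd sE] := dm y Ky.
  have [y0 y1 _ Ay cAy] := large y Ky.
  have sm := summable_moments S c m q A y S0 c_gt0 S2 A0 mA qn y1 Ay cAy.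
  split.
    have := summableB sd sm; apply: le_lt_trans; apply: le_esum => h _ /=.
    by rewrite mulrBl.
  transitivity (rsum S (fun g => q (d g * e g) * y `^ (- (g + 1)) -
      q (m g * e g) * y `^ (- (g + 1)))).
    by apply: eq_rsum => h _; rewrite mulrBl.
  by rewrite rsumB// sE subrr.
move=> g Sg.
(* The real series have the parts of [d g * e g] and [m g * e g] as coefficients, so these products
   are compared. *)
apply: (mulIf (cpow_i_neq0 g)); rewrite -/(e g).
apply/eqP; rewrite eq_complex; apply/andP; split; apply/eqP.
  apply: coef => //; first exact: norm_Re_le.
  move=> y Ky; have [y0 y1 _ Ay cAy] := large y Ky.
  (* The factor i puts the real parts of the coefficients into the imaginary part of G_mu. *)
  have [sd dE] := has_csum_Im _ _ _ _ (fun g => complex.Re (d g * e g)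
    * y `^ (- (g + 1)))
    (GN y Ky) (fun g _ => (div_cpow_Nimaginary _ _ _ y0).2).
  split=> //; rewrite dE Im_cauchy_transform//.
  by apply: (Rintegral_moments S c m _ A) => //; exact: norm_Re_le.
apply: coef => //; first exact: norm_Im_le.
move=> y Ky; have [y0 y1 _ Ay cAy] := large y Ky.
have [sd dE] := has_csum_Re _ _ _ _ (fun g => - (complex.Im (d g * e g)
  * y `^ (- (g + 1))))
  (GN y Ky) (fun g _ => (div_cpow_Nimaginary _ _ _ y0).1).
split.
  by apply: le_lt_trans sd; apply: le_esum => h _ /=; rewrite normrN.
(* The sign from multiplication by i and the sign in the real part of G_mu cancel. *)
apply: oppr_inj; rewrite -rsumN dE Re_cauchy_transform//; congr (- _).
by apply: (Rintegral_moments S c m _ A) => //; exact: norm_Im_le.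
Qed.
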